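(* Let $\mu$ be a locally-valid MV assignment of the square grid crease pattern $G_{m,n}$, and let $F$ be any face (unit square) of $G_{m,n}$. Then the MV assignment $\mu_F$ obtained from $\mu$ by flipping $F$ is also locally valid.
   Context: Let $m,n\ge 1$. The square grid crease pattern $G_{m,n}$ is the subdivision of an $m\times n$ rectangle $P$ (the paper) into $mn$ unit squares (the faces). The creases (edges) of $G_{m,n}$ are the unit segments of the grid that are shared by two faces (segments on the boundary of $P$ are not creases); $E(G_{m,n})$ is the set of creases. The interior vertices are the $(m-1)(n-1)$ grid points in the interior of $P$; each is incident to exactly four creases. A mountain-valley (MV) assignment is a function $\mu:E(G_{m,n})\to\{-1,1\}$ ($1$ = mountain, $-1$ = valley). It is locally valid if at every interior vertex $v$ the sum of $\mu(e)$ over the four creases $e$ at $v$ equals $2$ or $-2$ (three creases of one type and one of the other). Flipping a face $F$ under $\mu$ produces the MV assignment $\mu_F$ with $\mu_F(e)=-\mu(e)$ for every crease $e$ bordering $F$ and $\mu_F(e)=\mu(e)$ for all other creases. *)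

(* Defs.v *)
From mathcomp Require Import all_boot all_order all_algebra.

Set Implicit Arguments.
Unset Strict Implicit.
Unset Printing Implicit Defensive.

Import Order.TTheory GRing.Theory Num.Theory.
Local Open Scope ring_scope.

(* The grid points of the rectangle [0, m] x [0, n]. *)
Definition grid_point (m n : nat) : finType := ('I_m.+1 * 'I_n.+1)%type.

(* The face (i, j) is the unit square [i, i+1] x [j, j+1]. *)
Definition face (m n : nat) : finType := ('I_m * 'I_n)%type.

Definition corners m n (F : face m n) : {set grid_point m n} :=
  [set p : grid_point m n |
     (((p.1 : nat) == F.1) || ((p.1 : nat) == F.1.+1)) &&
     (((p.2 : nat) == F.2) || ((p.2 : nat) == F.2.+1))].

(* A unit segment is identified with the set of its two endpoints. *)
Definition unit_segment m n (e : {set grid_point m n}) : bool :=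
  [exists p : grid_point m n, exists q : grid_point m n,
     (e == [set p; q]) &&
     ((((q.1 : nat) == p.1.+1) && ((q.2 : nat) == p.2)) ||
      (((q.1 : nat) == p.1) && ((q.2 : nat) == p.2.+1)))].

(* For a unit segment e, having both endpoints among the corners of the unit
   square F means being one of the four sides of F. *)
Definition borders m n (e : {set grid_point m n}) (F : face m n) : bool :=
  e \subset corners F.

Definition is_crease m n (e : {set grid_point m n}) : bool :=
  unit_segment e && (#|[set F : face m n | borders e F]| == 2%N).

Definition crease (m n : nat) : finType :=
  {e : {set grid_point m n} | is_crease e}.

Definition interior m n (v : grid_point m n) : bool :=
  (0 < v.1 < m)%N && (0 < v.2 < n)%N.

(* The value 1 stands for mountain and -1 for valley. *)
Definition MV_assignment m n (mu : crease m n -> int) : Prop :=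
  forall e : crease m n, mu e = 1 \/ mu e = -1.

Definition locally_valid m n (mu : crease m n -> int) : Prop :=
  forall v : grid_point m n, interior v ->
    \sum_(e : crease m n | v \in val e) mu e = 2 \/
    \sum_(e : crease m n | v \in val e) mu e = -2.

Definition flip m n (mu : crease m n -> int) (F : face m n) :
    crease m n -> int :=
  fun e => if borders (val e) F then - mu e else mu e.

(* Main.v *)
Require Import Defs.
From mathcomp Require Import all_boot all_order all_algebra.
From mathcomp Require Import zify.

(** At an interior vertex [v] a face having [v] as a corner is bordered by
    exactly one of the two horizontal and one of the two vertical creases at
    [v]; any other face is bordered by none. If the signs at [v] are
    [x, x, x, -x], negating two of them again leaves three of one sign and one
    of the other: the odd one out is either among the two or not. *)

Local Open Scope ring_scope.

Lemma set2_injr (T : finType) (v w w' : T) :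
  w != v -> [set v; w] = [set v; w'] -> w = w'.
Proof.
by move=> wv /setP/(_ w); rewrite !inE eqxx orbT (negPf wv) => /esym/eqP.
Qed.

Lemma borders_set2 m n (p q : grid_point m n) (F : face m n) :
  borders [set p; q] F = (p \in corners F) && (q \in corners F).
Proof. by rewrite /borders subUset !sub1set. Qed.

Lemma grid_point_eq m n (p q : grid_point m n) :
  (p == q) = ((p.1 : nat) == q.1) && ((p.2 : nat) == q.2).
Proof. by case: p q => [a b] [c d]; rewrite xpair_eqE. Qed.

Lemma face_eq m n (F G : face m n) :
  (F == G) = ((F.1 : nat) == G.1) && ((F.2 : nat) == G.2).
Proof. by case: F G => [a b] [c d]; rewrite xpair_eqE. Qed.

(** A face is indexed by its lower left corner, so the faces just below and just above the segment
    are [(p.1, p.2.-1)] and [(p.1, p.2)]; the bounds on [p.2] place both inside the rectangle. *)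
Lemma is_crease_horizontal m n (p q : grid_point m n) :
  (q.1 : nat) = p.1.+1 -> (q.2 : nat) = p.2 -> (0 < p.2 < n)%N ->
  is_crease [set p; q].
Proof.
case: p q => [[a am] [b bn]] [[c cm] [d dn]] /= qc qd pb; apply/andP; split.
  apply/existsP; exists (Ordinal am, Ordinal bn).
  apply/existsP; exists (Ordinal cm, Ordinal dn).
  by rewrite eqxx /=; lia.
have a_lt : (a < m)%N by lia.
have b_lt : (b < n)%N by lia.
have b'_lt : (b.-1 < n)%N by lia.
rewrite (_ : [set F | _] =
  [set (Ordinal a_lt, Ordinal b'_lt); (Ordinal a_lt, Ordinal b_lt)]).
  by rewrite cards2 face_eq /=; lia.
apply/setP=> -[[i im] [j jn]].
by rewrite !inE borders_set2 !inE !face_eq /=; lia.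
Qed.

(** Here the two faces are those to the left and to the right, [(p.1.-1, p.2)] and [(p.1, p.2)]. *)
Lemma is_crease_vertical m n (p q : grid_point m n) :
  (q.1 : nat) = p.1 -> (q.2 : nat) = p.2.+1 -> (0 < p.1 < m)%N ->
  is_crease [set p; q].
Proof.
case: p q => [[a am] [b bn]] [[c cm] [d dn]] /= qc qd pb; apply/andP; split.
  apply/existsP; exists (Ordinal am, Ordinal bn).
  apply/existsP; exists (Ordinal cm, Ordinal dn).
  by rewrite eqxx /=; lia.
have a_lt : (a < m)%N by lia.
have a'_lt : (a.-1 < m)%N by lia.
have b_lt : (b < n)%N by lia.
rewrite (_ : [set F | _] =
  [set (Ordinal a'_lt, Ordinal b_lt); (Ordinal a_lt, Ordinal b_lt)]).
  by rewrite cards2 face_eq /=; lia.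
apply/setP=> -[[i im] [j jn]].
by rewrite !inE borders_set2 !inE !face_eq /=; lia.
Qed.

(** Reduces the theorem to arithmetic on four signs. The sum formula holds for every [f], so it
    serves both [mu] and [flip mu F]. A face with corner [v] lies on one side of [v] in each
    direction, hence the negations. *)
Lemma creases_at_interior m n (v : grid_point m n) : interior v ->
  exists r l u d : crease m n,
    (forall f : crease m n -> int,
       \sum_(e : crease m n | v \in val e) f e = f r + f l + (f u + f d)) /\
    (forall F : face m n,
       if v \in corners F
       then borders (val r) F = ~~ borders (val l) F /\
            borders (val u) F = ~~ borders (val d) F
       else [/\ ~~ borders (val r) F, ~~ borders (val l) F,
                ~~ borders (val u) F & ~~ borders (val d) F]).
Proof.
case: v => [[a am] [b bn]] /andP[/= a_int b_int].
have a_pred : (a.-1 < m.+1)%N by lia.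
have a_succ : (a.+1 < m.+1)%N by lia.
have b_pred : (b.-1 < n.+1)%N by lia.
have b_succ : (b.+1 < n.+1)%N by lia.
pose v : grid_point m n := (Ordinal am, Ordinal bn).
pose wr : grid_point m n := (Ordinal a_succ, Ordinal bn).
pose wl : grid_point m n := (Ordinal a_pred, Ordinal bn).
pose wu : grid_point m n := (Ordinal am, Ordinal b_succ).
pose wd : grid_point m n := (Ordinal am, Ordinal b_pred).
have cr : is_crease [set v; wr] by apply: is_crease_horizontal.
have cl : is_crease [set v; wl].
  (* The segment must be read from its left endpoint, which is [wl]. *)
  by rewrite setUC; apply: is_crease_horizontal => //=; lia.
have cu : is_crease [set v; wu] by apply: is_crease_vertical.
have cd : is_crease [set v; wd].
  by rewrite setUC; apply: is_crease_vertical => //=; lia.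
pose r : crease m n := Sub _ cr; pose l : crease m n := Sub _ cl.
pose u : crease m n := Sub _ cu; pose d : crease m n := Sub _ cd.
exists r, l, u, d; split=> [f|F]; last first.
  rewrite !SubK !borders_set2.
  case: F => [[i im] [j jn]].
  by case: ifP => [|->] //=; rewrite !inE /=; lia.
have neq (w w' : grid_point m n) (c : is_crease [set v; w])
    (c' : is_crease [set v; w']) : w != v -> w != w' ->
    (Sub _ c : crease m n) != Sub _ c'.
  move=> wv; apply: contraNneq => /(congr1 val).
  by rewrite !SubK => /(set2_injr _ _ _ _ wv) ->.
have us : uniq [:: r; l; u; d].
  by rewrite /= !inE !negb_or !neq // !grid_point_eq /=; lia.
(* As the four creases are distinct, summing over membership in the list gives each of them once. *)
transitivity (\sum_(e in [:: r; l; u; d]) f e); last first.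
  by rewrite -big_uniq //= !big_cons big_nil; lia.
apply: eq_bigl => e; rewrite !inE.
have valE (c : crease m n) : (e == c) = (val e == val c) by [].
rewrite !valE !SubK.
apply/idP/idP; last by case/or4P=> /eqP->; rewrite !inE eqxx.
(* Since [q] is one step right of or above [p], the case [v = p] forces [q] to be [wr] or [wu], and
   the case [v = q] forces [p] to be [wl] or [wd]. *)
move=> ve; have /andP[/existsP[p /existsP[q /andP[/eqP Ee pq]]] _] := valP e.
case: p q Ee pq => [[p1 p1m] [p2 p2n]] [[q1 q1m] [q2 q2n]] /= Ee pq.
move: ve; rewrite Ee !inE => /orP[]/eqP Ev; rewrite -Ev; case: Ev => Ea Eb.
- have /orP[/eqP->|/eqP->] : ((Ordinal q1m, Ordinal q2n) == wr)
                          || ((Ordinal q1m, Ordinal q2n) == wu).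
    by rewrite !grid_point_eq /=; lia.
  + by rewrite eqxx.
  + by rewrite eqxx !orbT.
- have /orP[/eqP->|/eqP->] : ((Ordinal p1m, Ordinal p2n) == wl)
                          || ((Ordinal p1m, Ordinal p2n) == wd).
    by rewrite !grid_point_eq /=; lia.
  + by rewrite setUC eqxx !orbT.
  + by rewrite setUC eqxx !orbT.
Qed.

Theorem theorem3p1 (m n : nat) (hm : (1 <= m)%N) (hn : (1 <= n)%N)
    (mu : crease m n -> int) (hmu : MV_assignment mu)
    (hvalid : locally_valid mu) (F : face m n) :
  MV_assignment (flip mu F) /\ locally_valid (flip mu F).
Proof.
split=> [e|v vi].
  by rewrite /flip; case: ifP => _; case: (hmu e) => ->; [right|left|left|right].
have [r [l [u [d [sumE bF]]]]] := creases_at_interior m n v vi.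
move: (hvalid v vi) (bF F); rewrite !sumE /flip => S4.
(* If [v] is not a corner of [F], no sign at [v] changes. *)
case: ifP => _; last by case=> /negPf-> /negPf-> /negPf-> /negPf->.
case=> -> ->; move: S4 (hmu r) (hmu l) (hmu u) (hmu d).
(* The four cases are the four positions of [F] around [v]. *)
by case: (borders (val l) F); case: (borders (val d) F) => /=; lia.
Qed.
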